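(* The only pairs $(Q,\alpha)$, up to isomorphism and reorientation of arrows, where $Q$ is a crab-shaped quiver with $g\ge1$ loops at its central vertex and $\alpha\in\mathcal{F}(Q)$ is a dimension vector in the fundamental region with all entries positive such that $\langle\alpha,\alpha\rangle=-1$, are the following: (1) $Q$ has a single vertex with two loops, and $\alpha=(1)$; (2) $Q$ has two vertices, a central vertex with one loop and one further vertex joined to it by a single arrow, and $\alpha$ has entry $2$ at the central vertex and entry $1$ at the other vertex.
   Context: A crab-shaped quiver is a quiver with a central vertex $v$ such that the arrows consist of $g$ loops at $v$ and finitely many legs (linear chains) attached to $v$. For a quiver $Q$ with vertices $Q_0$ and arrows $Q_1$ ($h(a),t(a)$ head and tail), $\langle\alpha,\beta\rangle=\sum_{i\in Q_0}\alpha_i\beta_i-\sum_{a\in Q_1}\alpha_{t(a)}\beta_{h(a)}$ and $(\alpha,\beta)=\langle\alpha,\beta\rangle+\langle\beta,\alpha\rangle$. The fundamental region $\mathcal{F}(Q)$ is the set of nonzero $\alpha\in\mathbb{N}^{Q_0}$ with connected support and $(\alpha,e_i)\le0$ for all coordinate vectors $e_i$. *)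

(* Defs.v *)
From mathcomp Require Import all_boot all_order all_algebra.

Set Implicit Arguments.
Unset Strict Implicit.
Unset Printing Implicit Defensive.

Import Order.TTheory GRing.Theory Num.Theory.
Local Open Scope ring_scope.

Record quiver := Quiver {
  vertex : finType;
  arrow : finType;
  tail : arrow -> vertex;
  head : arrow -> vertex
}.

Definition dim_vector (Q : quiver) := vertex Q -> nat.

Definition to_int (Q : quiver) (alpha : dim_vector Q) : vertex Q -> int :=
  fun i => (alpha i)%:Z.

Definition coord_vector (Q : quiver) (i : vertex Q) : dim_vector Q :=
  fun j => (j == i : nat).

Definition euler_form (Q : quiver) (x y : vertex Q -> int) : int :=
  \sum_(i : vertex Q) x i * y i
  - \sum_(a : arrow Q) x (tail a) * y (head a).

Definition sym_form (Q : quiver) (x y : vertex Q -> int) : int :=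
  euler_form x y + euler_form y x.

Definition adjacent (Q : quiver) : rel (vertex Q) := fun i j =>
  [exists a : arrow Q, ((tail a == i) && (head a == j))
                    || ((tail a == j) && (head a == i))].

Definition connected_support (Q : quiver) (alpha : dim_vector Q) : Prop :=
  forall i j, (0 < alpha i)%N -> (0 < alpha j)%N ->
    connect [rel x y | [&& (0 < alpha x)%N, (0 < alpha y)%N & adjacent x y]]
      i j.

Definition fundamental_region (Q : quiver) (alpha : dim_vector Q) : Prop :=
  [/\ exists i, alpha i != 0%N,
      connected_support alpha &
      forall i, sym_form (to_int alpha) (to_int (coord_vector i)) <= 0].

(* Isomorphism of the underlying undirected multigraphs: each arrow may be
   sent to an arrow with tail and head exchanged, independently of the other
   arrows. *)
Record reorient_iso (Q Q' : quiver) := ReorientIso {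
  vertex_map : vertex Q -> vertex Q';
  arrow_map : arrow Q -> arrow Q';
  vertex_map_bij : bijective vertex_map;
  arrow_map_bij : bijective arrow_map;
  arrow_map_ends : forall a : arrow Q,
    (tail (arrow_map a) = vertex_map (tail a) /\
     head (arrow_map a) = vertex_map (head a)) \/
    (tail (arrow_map a) = vertex_map (head a) /\
     head (arrow_map a) = vertex_map (tail a))
}.

Definition pair_iso (Q : quiver) (alpha : dim_vector Q)
    (Q' : quiver) (alpha' : dim_vector Q') : Prop :=
  exists f : reorient_iso Q Q', forall i, alpha' (vertex_map f i) = alpha i.

(* [None] is the central vertex, and [Some (i, j)] is the vertex at distance
   j + 1 from it on the i-th leg, which has [len i] vertices apart from the
   centre (a leg with [len i = 0] contributes nothing).  The arrow
   [inr (i, j)] joins [Some (i, j)] to the preceding vertex of the leg. *)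
Definition leg_index (k : nat) (len : 'I_k -> nat) : finType :=
  {i : 'I_k & 'I_(len i)}.

Definition leg_pred (k : nat) (len : 'I_k -> nat) (x : leg_index len) :
    option (leg_index len) :=
  let: existT i j := x in
  if j == 0%N :> nat then None
  else Some (existT (fun i => 'I_(len i)) i
               (Ordinal (leq_ltn_trans (leq_pred j) (ltn_ord j)))).

Definition crab (g k : nat) (len : 'I_k -> nat) : quiver :=
  @Quiver (option (leg_index len)) ('I_g + leg_index len)%type
    (fun a => match a with inl _ => None | inr x => Some x end)
    (fun a => match a with inl _ => None | inr x => leg_pred x end).

Definition crab_shaped (g : nat) (Q : quiver) : Prop :=
  exists (k : nat) (len : 'I_k -> nat), inhabited (reorient_iso Q (crab g len)).

Definition two_loop_quiver : quiver :=
  @Quiver unit 'I_2 (fun=> tt) (fun=> tt).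

Definition two_loop_dim : dim_vector two_loop_quiver := fun=> 1%N.

(* Vertex [true] is the centre, vertex [false] the other one; arrow [true] is
   the loop at the centre, arrow [false] goes from [false] to [true]. *)
Definition tailed_loop_quiver : quiver :=
  @Quiver bool bool (fun a => a) (fun=> true).

Definition tailed_loop_dim : dim_vector tailed_loop_quiver :=
  fun i => if i then 2%N else 1%N.

(* Main.v *)
From mathcomp Require Import all_boot all_order all_algebra.
From mathcomp Require Import zify ring.
Require Import Defs.

(** Write n for the entry of alpha at the centre and p(x) for the vertex
    preceding a leg vertex x, and pair each leg vertex with the arrow joining it
    to p(x).  The Euler form of a crab then becomes
      <alpha, alpha> =
        (1 - g) n^2 - sum over x of alpha_x (alpha_p(x) - alpha_x)
    ([crab_euler_form]).  The condition (alpha, e_x) <= 0 says that alpha is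
    convex along the legs, extended by 0 past the tip of each; so it decreases
    strictly away from the centre ([leg_strictly_decreasing]), and with positive
    entries every summand is at least 1.  When g >= 1, the value -1 therefore
    means that
      (g - 1) n^2 + sum over x of alpha_x (alpha_p(x) - alpha_x) = 1
    is a sum of nonnegative terms, exactly one of which is nonzero and equal
    to 1.  If it is the first one, there are no leg vertices, g = 2 and n = 1;
    if it belongs to a leg vertex x, then g = 1, x is the only leg vertex, and
    alpha_x = n - alpha_x = 1.

    All the conditions are invariant under isomorphism and reorientation,
    because they only depend on the symmetric form and on adjacency; this reduces
    one implication to crabs, and the converse to the two listed pairs. *)

Set Implicit Arguments.
Unset Strict Implicit.
Unset Printing Implicit Defensive.

Import Order.TTheory GRing.Theory Num.Theory.
Local Open Scope ring_scope.

(** * Invariance under isomorphism and reorientation *)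

Lemma pair_iso_sym (Q Q' : quiver) (alpha : dim_vector Q)
    (alpha' : dim_vector Q') :
  pair_iso alpha alpha' -> pair_iso alpha' alpha.
Proof.
case=> [[fv fa [gv fvK gvK] [ga faK gaK] fe] /= falpha].
have gv_bij : bijective gv by exists fv.
have ga_bij : bijective ga by exists fa.
have ge (a : arrow Q') :
    (tail (ga a) = gv (tail a) /\ head (ga a) = gv (head a)) \/
    (tail (ga a) = gv (head a) /\ head (ga a) = gv (tail a)).
  have := fe (ga a); rewrite gaK.
  by case=> [[-> ->]|[-> ->]]; rewrite !fvK; [left | right].
by exists (ReorientIso gv_bij ga_bij ge) => i /=; rewrite -falpha gvK.
Qed.

Lemma pair_iso_trans (Q1 Q2 Q3 : quiver) (a1 : dim_vector Q1)
    (a2 : dim_vector Q2) (a3 : dim_vector Q3) :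
  pair_iso a1 a2 -> pair_iso a2 a3 -> pair_iso a1 a3.
Proof.
case=> [[fv fa fvb fab fe] /= fa1] [[gv ga gvb gab ge] /= ga2].
have he (a : arrow Q1) :
    (tail (ga (fa a)) = gv (fv (tail a)) /\
     head (ga (fa a)) = gv (fv (head a))) \/
    (tail (ga (fa a)) = gv (fv (head a)) /\
     head (ga (fa a)) = gv (fv (tail a))).
  by case: (ge (fa a)) => [[-> ->]|[-> ->]]; case: (fe a) => [[-> ->]|[-> ->]];
    [left | right | right | left].
exists (@ReorientIso Q1 Q3 (gv \o fv) (ga \o fa)
          (bij_comp gvb fvb) (bij_comp gab fab) he) => i /=.
by rewrite ga2 fa1.
Qed.

Lemma sym_formE (Q : quiver) (x y : vertex Q -> int) :
  sym_form x y = \sum_i 2 * (x i * y i)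
    - \sum_a (x (tail a) * y (head a) + x (head a) * y (tail a)).
Proof.
rewrite /sym_form /euler_form big_split /= -mulr_sumr.
under [\sum_i y i * x i]eq_bigr do rewrite mulrC.
under [\sum_a y _ * x _]eq_bigr do rewrite mulrC.
ring.
Qed.

(** The Euler form itself depends on the orientation; its symmetrization does
    not. *)
Lemma sym_form_iso (Q Q' : quiver) (f : reorient_iso Q Q')
    (x y : vertex Q -> int) (x' y' : vertex Q' -> int) :
  (forall i, x' (vertex_map f i) = x i) ->
  (forall i, y' (vertex_map f i) = y i) ->
  sym_form x' y' = sym_form x y.
Proof.
move=> fx fy; rewrite !sym_formE; congr (_ - _).
  rewrite (reindex (vertex_map f)) /=; last exact/onW_bij/vertex_map_bij.
  by apply: eq_bigr => i _; rewrite fx fy.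
rewrite (reindex (arrow_map f)) /=; last exact/onW_bij/arrow_map_bij.
apply: eq_bigr => a _.
by case: (arrow_map_ends f a) => [[-> ->]|[-> ->]]; rewrite !fx !fy // addrC.
Qed.

Lemma euler_form_diag_iso (Q Q' : quiver) (alpha : dim_vector Q)
    (alpha' : dim_vector Q') :
  pair_iso alpha alpha' ->
  euler_form (to_int alpha') (to_int alpha') =
  euler_form (to_int alpha) (to_int alpha).
Proof.
case=> f falpha; have fint i : to_int alpha' (vertex_map f i) = to_int alpha i.
  by rewrite /to_int falpha.
have := sym_form_iso fint fint; rewrite /sym_form; lia.
Qed.

Lemma pair_iso_pos (Q Q' : quiver) (alpha : dim_vector Q)
    (alpha' : dim_vector Q') :
  pair_iso alpha alpha' ->
  (forall i, (0 < alpha i)%N) -> forall i, (0 < alpha' i)%N.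
Proof.
case=> f falpha pos i; have [g _ gK] := vertex_map_bij f.
by rewrite -(gK i) falpha.
Qed.

Lemma crab_shaped_iso (Q Q' : quiver) (alpha : dim_vector Q)
    (alpha' : dim_vector Q') (g : nat) :
  pair_iso alpha alpha' -> crab_shaped g Q -> crab_shaped g Q'.
Proof.
move=> /pair_iso_sym[f' fa] [k [len [f]]]; exists k, len.
have [h hK _] := vertex_map_bij f.
have f_pair : pair_iso alpha (alpha \o h : dim_vector (crab g len)).
  by exists f => i /=; rewrite hK.
have f'_pair : pair_iso alpha' alpha by exists f'.
by have [f'' _] := pair_iso_trans f'_pair f_pair; split.
Qed.

Lemma adjacent_iso (Q Q' : quiver) (f : reorient_iso Q Q') (i j : vertex Q) :
  adjacent i j -> adjacent (vertex_map f i) (vertex_map f j).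
Proof.
case/existsP=> a ija; apply/existsP; exists (arrow_map f a).
case/orP: ija => /andP[/eqP<- /eqP<-];
  by case: (arrow_map_ends f a) => [[-> ->]|[-> ->]]; rewrite !eqxx ?orbT.
Qed.

Lemma connected_support_iso (Q Q' : quiver) (alpha : dim_vector Q)
    (alpha' : dim_vector Q') :
  pair_iso alpha alpha' -> connected_support alpha -> connected_support alpha'.
Proof.
case=> f falpha conn i' j'; have [g _ gK] := vertex_map_bij f.
rewrite -(gK i') -(gK j') !falpha.
move: (g i') (g j') => i j i_pos j_pos.
case/connectP: (conn i j i_pos j_pos) => p.
elim: p i {i_pos} => [|k p IHp] i /=; first by move=> _ ->; exact: connect0.
case/andP=> /and3P[i_pos k_pos ik] kp jE.
apply: connect_trans (IHp k kp jE); apply: connect1 => /=.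
by rewrite !falpha i_pos k_pos adjacent_iso.
Qed.

Lemma fundamental_region_iso (Q Q' : quiver) (alpha : dim_vector Q)
    (alpha' : dim_vector Q') :
  pair_iso alpha alpha' ->
  fundamental_region alpha -> fundamental_region alpha'.
Proof.
move=> iso [[i0 i0_supp] conn neg]; split.
- by case: iso => f fa; exists (vertex_map f i0); rewrite fa.
- exact: connected_support_iso iso conn.
case: iso => f falpha i'; have [g _ gK] := vertex_map_bij f.
rewrite -(gK i') (@sym_form_iso _ _ f (to_int alpha)
  (to_int (coord_vector (g i')))) // => j; first by rewrite /to_int falpha.
by rewrite /to_int /coord_vector (inj_eq (bij_inj (vertex_map_bij f))).
Qed.

(** * Crabs *)

Section Crab.

Variables (g k : nat) (len : 'I_k -> nat).
Implicit Types (x y : leg_index len) (alpha : dim_vector (crab g len)).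

Lemma leg_index_eq x y :
  tag x = tag y -> tagged x = tagged y :> nat -> x = y.
Proof.
case: x y => [i j] [i' j'] /= ii'; case: _ / ii' j' => j' jj'.
by congr existT; apply: val_inj.
Qed.

Lemma leg_pred_Some x y :
  leg_pred y = Some x -> tag y = tag x /\ tagged y = (tagged x).+1 :> nat.
Proof.
case: y => i j /=; case: eqP => // j_neq0 [<-] /=; split=> //; lia.
Qed.

Lemma sum_arrow_crab (F : arrow (crab g len) -> int) :
  \sum_a F a = \sum_(l < g) F (inl l) + \sum_x F (inr x).
Proof. exact: big_sumType. Qed.

Lemma sum_vertex_crab (F : vertex (crab g len) -> int) :
  \sum_i F i = F None + \sum_x F (Some x).
Proof.
rewrite (bigD1 (None : vertex (crab g len))) //=.
rewrite (@reindex_omap _ _ _ (vertex (crab g len)) _ Some id) => [|[]] //=.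
by congr (_ + _); apply: eq_bigl => x; rewrite eqxx.
Qed.

Lemma crab_euler_form alpha :
  euler_form (to_int alpha) (to_int alpha) =
  (1 - g%:Z) * (alpha None)%:Z ^+ 2
  - \sum_x (alpha (Some x))%:Z
           * ((alpha (leg_pred x))%:Z - (alpha (Some x))%:Z).
Proof.
rewrite /euler_form sum_arrow_crab sum_vertex_crab /=.
rewrite sumr_const card_ord -mulr_natl natz.
under [in RHS]eq_bigr do rewrite mulrBr.
by rewrite sumrB /to_int; ring.
Qed.

(** The neighbours of a leg vertex are the preceding vertex and the vertices
    that it precedes, of which there is at most one. *)
Lemma crab_sym_form_leg alpha x :
  sym_form (to_int alpha) (to_int (coord_vector (Some x : vertex (crab g len))))
  = 2 * (alpha (Some x))%:Z - (alpha (leg_pred x))%:Z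
    - \sum_(y | leg_pred y == Some x) (alpha (Some y))%:Z.
Proof.
rewrite sym_formE sum_arrow_crab /= /to_int /coord_vector.
rewrite (bigD1 (Some x : vertex (crab g len))) //= eqxx mulr1.
rewrite [X in _ + X - _]big1 ?addr0; last by move=> i /negPf ->; rewrite !mulr0.
rewrite [X in _ - (X + _)]big1 ?add0r; last by move=> l _; rewrite !mulr0.
rewrite big_split /= opprD addrA addrAC; congr (_ - _ - _).
  rewrite (bigD1 x) //= eqxx mulr1 big1 ?addr0 // => y /negPf yx.
  by rewrite (inj_eq Some_inj) yx mulr0.
rewrite [RHS]big_mkcond; apply: eq_bigr => y _.
by case: eqP; rewrite ?mulr1 ?mulr0.
Qed.

(** By induction from the tip of the leg: convexity at x makes the drop from
    the preceding vertex to x at least the drop from x to the next vertex, and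
    past the tip the next entry counts as 0. *)
Lemma leg_strictly_decreasing alpha :
  (forall i, sym_form (to_int alpha) (to_int (coord_vector i)) <= 0) ->
  (forall i, (0 < alpha i)%N) ->
  forall x, (alpha (Some x) < alpha (leg_pred x))%N.
Proof.
move=> neg pos x.
have [m] := ubnP (len (tag x) - tagged x); elim: m x => // m IHm x x_lt.
have := neg (Some x); rewrite crab_sym_form_leg.
have x_pos := pos (Some x).
case: (pickP (fun y => leg_pred y == Some x)) => [y /eqP yx | no_next].
  have [tag_yx val_yx] := leg_pred_Some yx.
  have : (alpha (Some y) < alpha (Some x))%N.
    by rewrite -yx; apply: IHm; move: (ltn_ord (tagged x)); rewrite val_yx tag_yx; lia.
  rewrite (big_pred1 y) => [|z]; first by lia.
  apply/eqP/eqP => [zx | -> //]; have [tag_zx val_zx] := leg_pred_Some zx.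
  by apply: leg_index_eq; rewrite ?tag_zx ?val_zx.
by rewrite big_pred0 //; lia.
Qed.

End Crab.

Lemma two_loop_crab (k : nat) (len : 'I_k -> nat)
    (alpha : dim_vector (crab 2 len)) :
  #|leg_index len| = 0%N -> alpha None = 1%N -> pair_iso two_loop_dim alpha.
Proof.
move=> no_leg alphaN.
pose fv (_ : vertex two_loop_quiver) : vertex (crab 2 len) := None.
pose fa (l : arrow two_loop_quiver) : arrow (crab 2 len) := inl l.
have fvb : bijective fv.
  apply: inj_card_bij => [[] [] //|].
  by rewrite [X in (X <= _)%N]card_option no_leg card_unit.
have fab : bijective fa.
  apply: inj_card_bij => [l l' [] //|].
  by rewrite [X in (X <= _)%N]card_sum no_leg addn0.
have fe (a : arrow two_loop_quiver) :
    (tail (fa a) = fv (tail a) /\ head (fa a) = fv (head a)) \/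
    (tail (fa a) = fv (head a) /\ head (fa a) = fv (tail a)) by left.
by exists (ReorientIso fvb fab fe).
Qed.

Lemma tailed_loop_crab (k : nat) (len : 'I_k -> nat)
    (alpha : dim_vector (crab 1 len)) (x : leg_index len) :
  #|leg_index len| = 1%N -> leg_pred x = None ->
  alpha None = 2%N -> alpha (Some x) = 1%N -> pair_iso tailed_loop_dim alpha.
Proof.
move=> one_leg x_pred alphaN alphax.
pose fv (v : vertex tailed_loop_quiver) : vertex (crab 1 len) :=
  if v then None else Some x.
pose fa (a : arrow tailed_loop_quiver) : arrow (crab 1 len) :=
  if a then inl ord0 else inr x.
have fvb : bijective fv.
  apply: inj_card_bij => [[] [] //|].
  by rewrite [X in (X <= _)%N]card_option one_leg card_bool.
have fab : bijective fa.
  apply: inj_card_bij => [[] [] //|].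
  by rewrite [X in (X <= _)%N]card_sum one_leg card_ord card_bool.
have fe (a : arrow tailed_loop_quiver) :
    (tail (fa a) = fv (tail a) /\ head (fa a) = fv (head a)) \/
    (tail (fa a) = fv (head a) /\ head (fa a) = fv (tail a)).
  by case: a; left.
by exists (ReorientIso fvb fab fe); case.
Qed.

Lemma crab_classification (g k : nat) (len : 'I_k -> nat)
    (alpha : dim_vector (crab g len)) :
  (1 <= g)%N -> fundamental_region alpha -> (forall i, (0 < alpha i)%N) ->
  euler_form (to_int alpha) (to_int alpha) = -1 ->
  pair_iso two_loop_dim alpha \/ pair_iso tailed_loop_dim alpha.
Proof.
move=> g_gt0 [_ _ neg] pos; rewrite crab_euler_form.
have decr := leg_strictly_decreasing neg pos.
(* The drops are positive, so they can be computed by truncated subtraction. *)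
pose drop_term (x : leg_index len) :=
  (alpha (Some x) * (alpha (leg_pred x) - alpha (Some x)))%N.
have drop_gt0 x : (0 < drop_term x)%N.
  by rewrite muln_gt0 pos subn_gt0 decr.
have -> : \sum_x (alpha (Some x))%:Z *
    ((alpha (leg_pred x))%:Z - (alpha (Some x))%:Z) =
    (\sum_x drop_term x)%N%:Z.
  rewrite -natz natr_sum; apply: eq_bigr => x _.
  by rewrite natz /drop_term PoszM -subzn // ltnW.
have n_gt0 := pos None.
(* From here on g stands for the number of loops minus one. *)
case: g g_gt0 alpha => // g _ alpha
  in neg pos decr drop_term drop_gt0 n_gt0 *.
move=> euler.
have sum1 : (g * alpha None ^ 2 + \sum_x drop_term x = 1)%N by nia.
have card_le : (#|leg_index len| <= \sum_x drop_term x)%N.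
  by rewrite -sum1_card; apply: leq_sum => x _.
case: (posnP #|leg_index len|) => [no_leg | leg_gt0].
  left; move: sum1; rewrite big1 ?addn0; last first.
    by move=> x _; have := fintype0 x no_leg.
  move=> /eqP; rewrite muln_eq1 => /andP[/eqP g1].
  rewrite -mulnn muln_eq1 andbb => /eqP alphaN.
  by subst g; apply: two_loop_crab.
right; have g0 : g = 0%N by nia.
have one_leg : #|leg_index len| = 1%N by lia.
subst g; have /fintype1P[x x_only] : #|leg_index len| == 1%N by apply/eqP.
(* A leg vertex cannot precede itself, as the entries would not drop. *)
have x_pred : leg_pred x = None.
  by have := decr x; case: (leg_pred x) => // y; rewrite (x_only y) ltnn.
have /eqP : drop_term x = 1%N.
  move: sum1; rewrite mul0n add0n (big_pred1 x) // => y.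
  by rewrite (x_only y) /= eqxx.
rewrite muln_eq1 x_pred => /andP[/eqP alphax /eqP alphaN].
rewrite alphax subn1 in alphaN.
by apply: tailed_loop_crab one_leg x_pred _ alphax;
  rewrite -(prednK n_gt0) alphaN.
Qed.

(** * The two exceptional pairs *)

Lemma crab_shaped_two_loop : crab_shaped 2 two_loop_quiver.
Proof.
exists 0%N, (fun=> 0%N).
have [|//|f _] := @two_loop_crab 0 (fun=> 0%N) (fun=> 1%N).
  by apply: eq_card0 => -[[]].
by split.
Qed.

Lemma crab_shaped_tailed_loop : crab_shaped 1 tailed_loop_quiver.
Proof.
exists 1%N, (fun=> 1%N).
pose alpha : dim_vector (crab 1 (fun _ : 'I_1 => 1%N)) :=
  fun v => if v is None then 2%N else 1%N.
pose x : leg_index (fun _ : 'I_1 => 1%N) := existT _ ord0 ord0.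
have [||//|//|f _] := @tailed_loop_crab 1 (fun=> 1%N) alpha x; last by split.
  by rewrite card_tagged sumnE big_map big_enum big_ord1 card_ord.
by [].
Qed.

Lemma two_loop_region : fundamental_region two_loop_dim.
Proof.
split; first by exists tt.
  by move=> [] [] _ _; apply: connect0.
case; rewrite sym_formE /to_int /coord_vector /=.
by rewrite (big_pred1 tt) //= 2!big_ord_recl big_ord0; vm_compute.
Qed.

Lemma tailed_loop_region : fundamental_region tailed_loop_dim.
Proof.
split; first by exists true.
  move=> i j _ _; case: i; case: j; try exact: connect0;
    by apply: connect1; apply/existsP; exists false.
by case; rewrite sym_formE !big_bool /to_int /coord_vector /=.
Qed.

Theorem theorem5p3 (Q : quiver) (alpha : dim_vector Q) :
  [/\ exists2 g : nat, (1 <= g)%N & crab_shaped g Q,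
      fundamental_region alpha,
      forall i : vertex Q, (0 < alpha i)%N &
      euler_form (to_int alpha) (to_int alpha) = -1]
  <->
  pair_iso alpha two_loop_dim \/ pair_iso alpha tailed_loop_dim.
Proof.
split.
  case=> [[g g_gt0 [k [len [f]]]] region pos euler].
  have [h hK _] := vertex_map_bij f.
  have iso : pair_iso alpha (alpha \o h : dim_vector (crab g len)).
    by exists f => i /=; rewrite hK.
  have [] := crab_classification g_gt0 (fundamental_region_iso iso region)
    (pair_iso_pos iso pos) (etrans (euler_form_diag_iso iso) euler).
    by move=> /pair_iso_sym std; left; apply: pair_iso_trans iso std.
  by move=> /pair_iso_sym std; right; apply: pair_iso_trans iso std.
case=> /pair_iso_sym iso; split.
- by exists 2%N => //; apply: crab_shaped_iso iso crab_shaped_two_loop.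
- exact: fundamental_region_iso iso two_loop_region.
- exact: pair_iso_pos iso _.
- rewrite (euler_form_diag_iso iso) /euler_form (big_pred1 tt) //.
  by rewrite 2!big_ord_recl big_ord0.
- by exists 1%N => //; apply: crab_shaped_iso iso crab_shaped_tailed_loop.
- exact: fundamental_region_iso iso tailed_loop_region.
- by apply: pair_iso_pos iso _; case.
by rewrite (euler_form_diag_iso iso) /euler_form !big_bool.
Qed.
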